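(* For every pair of constants $0 < \alpha, \beta < 1$ satisfying $\beta + 40\alpha^2 < \frac{1}{2}$, there exists a constant $N = N(\alpha,\beta) \geq 1$ such that the following holds for all integers $n \geq N$. Let $m$ be any integer satisfying $$2n \leq m \leq \alpha \cdot n^{3/2},$$ and let $G \subset K_n$ be any connected graph containing $n$ vertices, $b$ edges and having maximum vertex degree $\Delta$. If $$\Delta \leq \beta \cdot n \quad\text{and}\quad b \leq m - n,$$ then $G$ is $m$-Eulerian extendable.
   Context: Graphs are finite and simple (no loops, no multiple edges); $K_n$ denotes the complete graph on $n$ vertices. The degree of a vertex $v$ in $G$ is the number of vertices adjacent to $v$ in $G$. A sequence of vertices $\mathcal{W} = (u_1,u_2,\ldots,u_t)$ of a graph is a walk if $u_i$ is adjacent to $u_{i+1}$ for each $1 \leq i \leq t-1$. If in addition $u_t$ is adjacent to $u_1$, then $\mathcal{W}$ is a circuit (whose edges are the $(u_i,u_{i+1})$, $1\le i\le t-1$, together with $(u_t,u_1)$). A circuit $\mathcal{W}$ is an Eulerian circuit of a graph if each edge of the graph occurs exactly once in $\mathcal{W}$. A graph is Eulerian if it contains an Eulerian circuit. A graph $H$ is an Eulerian extension of a graph $G$ if $G$ and $H$ have the same vertex set, $G$ is a subgraph of $H$, and $H$ is Eulerian. For an integer $m \geq 1$, a graph $G$ is $m$-Eulerian extendable if there exists an Eulerian extension $H$ of $G$ containing exactly $m$ edges. The constant $N$ depends only on $\alpha$ and $\beta$ (not on $n$, $m$ or $G$). *)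

(* Defs.v *)
From mathcomp Require Import all_boot.
Set Implicit Arguments.
Unset Strict Implicit.
Unset Printing Implicit Defensive.

Record sgraph (T : finType) := SGraph {
  adj : rel T;
  adj_sym : symmetric adj;
  adj_irrefl : irreflexive adj
}.

Definition edges (T : finType) (G : sgraph T) : {set {set T}} :=
  [set [set p.1; p.2] | p : T * T & adj G p.1 p.2].

Definition degree (T : finType) (G : sgraph T) (v : T) : nat :=
  #|[set w | adj G v w]|.

Definition max_degree (T : finType) (G : sgraph T) : nat :=
  \max_(v : T) degree G v.

Definition connected_graph (T : finType) (G : sgraph T) : Prop :=
  forall x y : T, connect (adj G) x y.

(* The closing vertex is not repeated: [cycle] itself requires the last vertex
   of [c] to be adjacent to the first.  It accepts the empty sequence, which is
   not a circuit (u_1, ..., u_t). *)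
Definition circuit (T : finType) (G : sgraph T) (c : seq T) : bool :=
  (c != [::]) && cycle (adj G) c.

(* The edges u_1u_2, ..., u_(t-1)u_t, u_tu_1, with multiplicity. *)
Definition circuit_edges (T : finType) (c : seq T) : seq {set T} :=
  [seq [set p.1; p.2] | p <- zip c (rot 1 c)].

Definition eulerian_circuit (T : finType) (G : sgraph T) (c : seq T) : Prop :=
  circuit G c /\
  forall f : {set T}, f \in edges G -> count_mem f (circuit_edges c) = 1.

Definition eulerian (T : finType) (G : sgraph T) : Prop :=
  exists c : seq T, eulerian_circuit G c.

Definition eulerian_extension (T : finType) (G H : sgraph T) : Prop :=
  subrel (adj G) (adj H) /\ eulerian H.

Definition eulerian_extendable (T : finType) (m : nat) (G : sgraph T) : Prop :=
  exists H : sgraph T, eulerian_extension G H /\ #|edges H| = m.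

(* Main.v *)
(** Only vertices of odd degree obstruct Euler's theorem, so it is enough to add
    [k = m - b >= n] non-edges of [G] making all degrees even.  Fix an even [D]
    with [beta n <= D] and [n / 2 - D] linear in [n].  As long as the degrees stay
    at most [D] and there are at most [m = O(n^(3/2))] edges, only [O(sqrt n)]
    vertices have degree above [D - 2], so any two vertices [x], [y] have a common
    non-neighbour [z] of degree at most [D - 2].  If [x] and [y] are odd, adding
    [xz] and [zy] removes both from the set of odd vertices at the cost of two
    edges, which is affordable since there are at most [n <= k] odd vertices.
    When just two odd vertices [x], [y] are left and more than two edges remain to
    be added, adding the single edge [xz] replaces them by [z], [y]; this burns
    the excess edges one at a time. *)
Require Import Defs.
From HB Require Import structures.
From mathcomp Require Import all_boot all_order all_algebra.
From mathcomp Require Import reals exp.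
From mathcomp Require Import zify ring lra.
Set Implicit Arguments.
Unset Strict Implicit.
Unset Printing Implicit Defensive.

(** * Edges, degrees and the handshake identity *)

Section Euler.
Variables (T : finType) (G : sgraph T).
Implicit Types (x y v : T) (p : seq T).

Lemma edgesP (e : {set T}) :
  reflect (exists2 q : T * T, adj G q.1 q.2 & e = [set q.1; q.2]) (e \in edges G).
Proof.
apply: (iffP imsetP) => [[q]|[q Gq ->]]; first by rewrite inE; exists q.
by exists q; rewrite ?inE.
Qed.

Lemma mem_edges x y : ([set x; y] \in edges G) = adj G x y.
Proof.
apply/edgesP/idP => [[[a b] /= Gab E]|Gxy]; last by exists (x, y).
have ab : a != b by apply: contraTneq Gab => ->; rewrite adj_irrefl.
have := set21 a b; have := set22 a b; rewrite -E !inE.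
case/orP => /eqP eb /orP[/eqP ea | /eqP ea]; subst; rewrite ?eqxx // in ab *.
by rewrite adj_sym.
Qed.

Lemma set2_inj v : injective (fun w : T => [set v; w]).
Proof.
move=> a b E; have := set22 v a; have := set22 v b.
rewrite {1}[[set v; b]](esym E) {2}[[set v; a]]E !inE.
by case/orP=> /eqP-> // /orP[/eqP|/eqP].
Qed.

Lemma card_incident v : #|[set e in edges G | v \in e]| = degree G v.
Proof.
rewrite /degree -(card_imset _ (@set2_inj v)); congr #|pred_of_set _|.
apply/setP=> e; rewrite inE; apply/andP/imsetP => [[/edgesP[[a b] /= Gab ->]]|].
  rewrite !inE => /orP[] /eqP->; first by exists b; rewrite ?inE.
  by exists a; rewrite ?inE 1?adj_sym // setUC.
by case=> w; rewrite inE => Gvw ->; rewrite mem_edges set21.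
Qed.

Lemma card_edge (e : {set T}) : e \in edges G -> #|e| = 2.
Proof.
case/edgesP=> -[a b] /= Gab ->; rewrite cards2.
by case: eqP Gab => // ->; rewrite adj_irrefl.
Qed.

Lemma handshake : \sum_v degree G v = #|edges G|.*2.
Proof.
under eq_bigr do rewrite -card_incident -sum1_card.
under eq_bigr do (rewrite big_mkcond; under eq_bigr do rewrite inE if_and).
rewrite exchange_big /=.
under eq_bigr => e _.
  rewrite (_ : \sum_i _ = if e \in edges G then 2 else 0); last first.
    case: ifP => [eG|_]; last by rewrite big1.
    by rewrite -big_mkcond /= sum1_card card_edge.
  over.
by rewrite -big_mkcond sum_nat_const muln2.
Qed.

(** * Trails and Euler's theorem *)

Fixpoint walk_edges x p : seq {set T} :=
  if p is y :: p' then [set x; y] :: walk_edges y p' else [::].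

Lemma size_walk_edges x p : size (walk_edges x p) = size p.
Proof. by elim: p x => //= y p IHp x; rewrite IHp. Qed.

Lemma circuit_edges_cons x p :
  circuit_edges (x :: p) = walk_edges x (rcons p x).
Proof.
(* The closing vertex becomes an independent [z], so that induction on [p] may change the starting
   vertex. *)
rewrite /circuit_edges rot1_cons; move: {2 4}x => z.
by elim: p x => //= y p IHp x; rewrite IHp.
Qed.

Lemma circuit_edges_rot i (c : seq T) :
  circuit_edges (rot i c) = rot i (circuit_edges c).
Proof.
rewrite /circuit_edges -map_rot rot_rot; congr map.
have: size c = size (rot 1 c) by rewrite size_rot.
move: (rot 1 c) => d ecd; rewrite /rot zip_cat ?size_drop ?ecd //.
by congr (_ ++ _); elim: c d i {ecd} => [|a c IHc] [|b d] [|i] //=; rewrite ?IHc //; case: drop.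
Qed.

Lemma walk_edges_sub x p : path (adj G) x p -> {subset walk_edges x p <= edges G}.
Proof.
elim: p x => //= y p IHp x /andP[Gxy Gp] e; rewrite inE => /orP[/eqP->|].
  by rewrite mem_edges.
exact: IHp.
Qed.

Lemma walk_edges_mem x p v (e : {set T}) :
  e \in walk_edges x p -> v \in e -> v \in x :: p.
Proof.
elim: p x => //= y p IHp x; rewrite inE => /orP[/eqP->|ep ve].
  by rewrite !inE => /orP[] ->; rewrite ?orbT.
by rewrite inE (IHp y) ?orbT.
Qed.

(** Modulo 2 each edge contributes the indicators of its two distinct ends; the sum telescopes along
    the walk. *)
Lemma odd_count_walk x p v : path (adj G) x p ->
  odd (count (fun e : {set T} => v \in e) (walk_edges x p))
  = (v == x) (+) (v == last x p).
Proof.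
elim: p x => [x _|y p IHp x /= /andP[Gxy Gp]] /=; first by rewrite addbb.
rewrite oddD IHp // oddb !inE addbA; congr (_ (+) _).
have xy : x != y by apply: contraTneq Gxy => ->; rewrite adj_irrefl.
by case: (eqVneq v x) => [->|]; case: (eqVneq _ y) => //= e; rewrite e eqxx in xy.
Qed.

(** The trail uses every edge at [x] exactly once, an even number in all, whereas an open trail uses
    an odd number of edges at its first vertex. *)
Lemma saturated_trail_closed x p :
  path (adj G) x p -> uniq (walk_edges x p) ->
  (forall w, adj G x w -> [set x; w] \in walk_edges x p) ->
  ~~ odd (degree G x) -> last x p = x.
Proof.
move=> Gp up sat; suff <- : count (fun e : {set T} => x \in e) (walk_edges x p) = degree G x.
  by rewrite odd_count_walk // eqxx; case: eqP.
rewrite -card_incident -size_filter.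
have /card_uniqP <- := filter_uniq (fun e : {set T} => x \in e) up.
apply: eq_card => e; rewrite mem_filter inE andbC.
apply/andP/andP => -[ep xe]; split=> //; first exact: walk_edges_sub ep.
case/edgesP: ep xe => -[a b] /= Gab ->; rewrite !inE => /orP[] /eqP E; subst.
  exact: sat.
by rewrite setUC sat // adj_sym.
Qed.

(* A trail whose first vertex has an unused edge extends at that end; otherwise it
   is closed, and a closed trail can be rotated to start at any of its vertices. *)
Lemma circuit_of_trail x p :
    connected_graph G -> (forall v, ~~ odd (degree G v)) ->
    path (adj G) x p -> uniq (walk_edges x p) -> p != [::] ->
  eulerian G.
Proof.
(* Induction on the number of edges not yet in the trail. *)
move=> conG evG; move: {2}_.+1 (ltnSn (#|edges G| - size p)) => k.
elim: k x p => // k IHk x p; rewrite ltnS => lek Gp up pn0.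
have extend y w q : path (adj G) y q -> uniq (walk_edges y q) ->
    size q = size p -> adj G y w -> [set y; w] \notin walk_edges y q -> eulerian G.
  move=> Gq uq sq Gyw nyw; apply: (IHk w (y :: q)) => //=; last 2 first.
  - by rewrite adj_sym Gyw.
  - by rewrite setUC nyw.
  suff : size q < #|edges G| by rewrite sq; move: #|edges G| lek => M; lia.
  have u' : uniq (walk_edges w (y :: q)) by rewrite /= setUC nyw.
  rewrite -(size_walk_edges y q) -[_.+1]/(size (walk_edges w (y :: q))).
  rewrite -(card_uniqP u') subset_leq_card //; apply/subsetP.
  by apply: walk_edges_sub; rewrite /= adj_sym Gyw.
case: (pickP (fun w => adj G x w && ([set x; w] \notin walk_edges x p))).
  by move=> w /andP[]; apply: extend.
move=> sat; have lastx : last x p = x.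
  apply: saturated_trail_closed => // w Gxw.
  by have := sat w; rewrite Gxw => /negbFE.
(* Drop the repeated end of the closed trail, since [circuit] does not repeat its first vertex. *)
case/lastP: p => [|p y] in Gp up pn0 lek extend sat lastx *; first by [].
rewrite last_rcons in lastx; subst y.
set c := x :: p; rewrite -circuit_edges_cons -/c in up.
have Gc : cycle (adj G) c by [].
case: (pickP (fun q : T * T => [&& q.1 \in c, adj G q.1 q.2
                                 & [set q.1; q.2] \notin circuit_edges c])).
  case=> y w /= /and3P[yc Gyw nyw]; case/rot_to: yc => i d rotc.
  have Gd : cycle (adj G) (y :: d) by rewrite -rotc rot_cycle.
  have ceq : rot i (circuit_edges c) = walk_edges y (rcons d y).
    by rewrite -circuit_edges_rot rotc circuit_edges_cons.
  apply: (extend y w (rcons d y)) => //; rewrite -?ceq ?rot_uniq ?mem_rot //.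
  by have := congr1 size rotc; rewrite size_rot /= !size_rcons => ->.
move=> none.
have used y w : y \in c -> adj G y w -> [set y; w] \in circuit_edges c.
  by move=> yc Gyw; have := none (y, w); rewrite /= yc Gyw => /negbFE.
(* With every edge at a vertex of [c] used, [c] is closed under adjacency; by connectedness it meets
   every vertex, hence contains every edge. *)
have clc : closed (adj G) (mem c).
  apply: intro_closed => [|a b Gab ac]; first exact: sym_connect_sym (@adj_sym _ G).
  have := used a b ac Gab; rewrite circuit_edges_cons => /walk_edges_mem H.
  by have := H b (set22 a b); rewrite !inE mem_rcons inE; case: eqP.
exists c; split; first by rewrite /circuit Gc.
move=> f /edgesP[[a b] /= Gab ->]; rewrite count_uniq_mem // used //.
by rewrite -[_ \in c](closed_connect clc (conG x a)) mem_head.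
Qed.

Lemma euler_circuit :
    connected_graph G -> (forall v, ~~ odd (degree G v)) -> edges G != set0 ->
  eulerian G.
Proof.
move=> conG evG /set0Pn[e /edgesP[[a b] /= Gab _]].
by apply: (@circuit_of_trail a [:: b]); rewrite //= Gab.
Qed.
End Euler.

(** * Adding an edge and its effect on parities *)

Section Extension.
Variable T : finType.
Implicit Types (G H : sgraph T) (u v w x y z : T).

(** The guard [u != v] keeps the relation irreflexive, so that [add_edge] is total. *)
Definition adj_add H u v : rel T := fun a b =>
  adj H a b || (u != v) && ((a == u) && (b == v) || (a == v) && (b == u)).

Lemma adj_add_sym H u v : symmetric (adj_add H u v).
Proof.
move=> a b; rewrite /adj_add adj_sym; congr (_ || _ && _).
by rewrite orbC andbC [(a == u) && _]andbC.
Qed.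

Lemma adj_add_irrefl H u v : irreflexive (adj_add H u v).
Proof.
move=> a; rewrite /adj_add adj_irrefl /=; case: (eqVneq a u) => [->|_] /=.
  by case: (eqVneq u v).
by rewrite andbF andbF.
Qed.

Definition add_edge H u v := SGraph (adj_add_sym H u v) (adj_add_irrefl H u v).

Lemma sub_add_edge H u v : subrel (adj H) (adj (add_edge H u v)).
Proof. by move=> a b Hab; rewrite /= /adj_add Hab. Qed.

Lemma edges_add H u v : u != v ->
  edges (add_edge H u v) = [set u; v] |: edges H.
Proof.
move=> uv; apply/setP=> e; rewrite !inE; apply/edgesP/idP => [[[a b] /=]|].
  rewrite /adj_add uv /= => /orP[Hab ->|]; first by rewrite mem_edges Hab orbT.
  by case/orP=> /andP[/eqP-> /eqP->] ->; rewrite ?[[set v; u]]setUC eqxx.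
case/orP=> [/eqP-> | /edgesP[[a b] /= Hab ->]].
  by exists (u, v); rewrite //= /adj_add uv !eqxx orbT.
by exists (a, b); rewrite //= /adj_add Hab.
Qed.

Lemma card_edges_add H u v : u != v -> ~~ adj H u v ->
  #|edges (add_edge H u v)| = #|edges H|.+1.
Proof. by move=> uv nuv; rewrite edges_add // cardsU1 mem_edges nuv. Qed.

Lemma degree_add H u v w : u != v -> ~~ adj H u v ->
  degree (add_edge H u v) w = degree H w + ((w == u) || (w == v)).
Proof.
move=> uv nuv; rewrite -!card_incident edges_add //.
case: (boolP ((w == u) || _)) => wuv.
  rewrite (_ : [set e in _ | _] = [set u; v] |: [set e in edges H | w \in e]).
    by rewrite cardsU1 inE mem_edges (negPf nuv) addnC.
  by apply/setP=> e; rewrite !inE; case: eqP => //= ->; rewrite !inE wuv.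
rewrite addn0; congr #|pred_of_set _|; apply/setP=> e; rewrite !inE.
by case: eqP => //= ->; rewrite !inE (negPf wuv) andbF.
Qed.

Definition odd_vertices H := [set v | odd (degree H v)].

Lemma odd_vertices_add H u v : u != v -> ~~ adj H u v ->
  odd_vertices (add_edge H u v)
  = [set w | (w \in odd_vertices H) (+) ((w == u) || (w == v))].
Proof.
by move=> uv nuv; apply/setP=> w; rewrite !inE degree_add // oddD; case: orb.
Qed.

Lemma even_odd_vertices H : ~~ odd #|odd_vertices H|.
Proof.
rewrite -sum1_card big_mkcond /=.
under eq_bigr do rewrite inE -[if _ then 1 else 0]/(nat_of_bool (odd _)).
have := handshake H; under eq_bigr do rewrite -[degree H _]odd_double_half.
rewrite big_split /= -(big_morph double doubleD (erefl : 0.*2 = 0)).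
by move/(congr1 odd); rewrite oddD !odd_double addbF => ->.
Qed.

(** * Completion to an even graph under a degree cap *)

Variables D m : nat.
Hypothesis evD : ~~ odd D.
(* [room] says that fewer than [#|T| - 2 * D.+1] vertices can have degree at least
   [D.-1] in a graph with at most [m] edges. *)
Hypothesis room : D.+1.*2 * D.-1 + m.*2 < #|T| * D.-1.

(** The closed neighbourhoods of [x] and [y] contain at most [D.+1.*2] vertices, and by the
    handshake identity too few vertices have degree at least [D.-1] to cover the rest. The case
    [x = y] is allowed. *)
Lemma common_nonneighbor H x y :
    (forall v, degree H v <= D) -> #|edges H| <= m ->
  exists z, [/\ z != x, z != y, ~~ adj H x z, ~~ adj H y z & degree H z + 2 <= D].
Proof.
move=> degD em.
case: (pickP (fun z => [&& z != x, z != y, ~~ adj H x z, ~~ adj H y z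
                         & degree H z + 2 <= D])).
  by move=> z /and5P[*]; exists z.
move=> none; exfalso; move: room; apply/negP; rewrite -leqNgt.
pose N v := v |: [set w | adj H v w]; pose S := [set z | D.-1 <= degree H z].
have cN v : #|N v| <= D.+1.
  by rewrite cardsU1 inE adj_irrefl /= add1n ltnS degD.
have cover : #|T| <= D.+1.*2 + #|S|.
  rewrite -cardsT; apply: (@leq_trans #|N x :|: N y :|: S|).
    apply/subset_leq_card/subsetP => z _; have := none z; rewrite !inE.
    case: (z == x) => //=; case: (z == y); rewrite ?orbT //=.
    case: (adj H x z); rewrite ?orbT //=; case: (adj H y z); rewrite ?orbT //=.
    lia.
  apply: leq_trans (leq_card_setU _ _) _; rewrite leq_add2r.
  by apply: leq_trans (leq_card_setU _ _) _; rewrite -addnn leq_add.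
have cS : #|S| * D.-1 <= m.*2.
  apply: (@leq_trans #|edges H|.*2); last by rewrite leq_double.
  rewrite -handshake -sum_nat_const big_mkcond /= leq_sum // => v _.
  by rewrite inE; case: ifP.
apply: leq_trans (leq_mul cover (leqnn D.-1)) _.
by rewrite mulnDl leq_add2l.
Qed.

(* An odd vertex has degree at most [D.-1] since [D] is even, so the bound [D]
   survives each step.  The last hypothesis excludes [k = 1, 2]: no nonempty even
   graph has so few edges. *)
Lemma even_completion k H :
    (forall v, degree H v <= D) -> m = #|edges H| + k ->
    #|odd_vertices H| <= k -> ~~ odd #|odd_vertices H| ->
    (#|odd_vertices H| = 0 -> k = 0 \/ 2 < k) ->
  exists H', [/\ subrel (adj H) (adj H'), #|edges H'| = m
               & odd_vertices H' = set0].
Proof.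
elim/ltn_ind: k H => k IHk H degD mE Tk evT T0.
have em : #|edges H| <= m by rewrite mE leq_addr.
have step x z j : z != x -> ~~ adj H x z -> degree H x < D -> degree H z < D ->
    k = j.+1 -> #|odd_vertices (add_edge H x z)| = 2 -> 1 < j ->
    exists H', [/\ subrel (adj H) (adj H'), #|edges H'| = m & odd_vertices H' = set0].
  move=> zx nxz dx dz kj T2 j2; rewrite eq_sym in zx.
  case: (IHk j _ (add_edge H x z)); rewrite ?kj ?T2 // ?card_edges_add //.
  - move=> v; rewrite degree_add //; case: (eqVneq v x) => [->|]; first by rewrite addn1.
    by case: (eqVneq v z) => [->|]; rewrite ?addn1 ?addn0.
  - by rewrite mE kj addSnnS.
  move=> H' [sub eH' TH']; exists H'; split=> // a b Hab.
  exact/sub/sub_add_edge.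
have oddlt x : x \in odd_vertices H -> degree H x < D.
  rewrite inE ltn_neqAle degD andbT => odx; by apply: contraNneq evD => <-.
have lt2 z : degree H z + 2 <= D -> degree H z < D by rewrite addn2 => /ltnW.
case: (posnP #|odd_vertices H|) => [T0E|].
  case: (T0 T0E) => [k0|k2].
    exists H; split=> //; last exact: cards0_eq.
    by rewrite mE k0 addn0.
  (* All degrees are even but edges remain to be added: join two non-adjacent vertices of low
     degree, making exactly these two odd. The vertex [a] only serves to obtain the first one,
     [x]. *)
  have [a _] : exists a : T, true.
    by case: (pickP (mem T)) => [a _|/eq_card0 c0]; [exists a | move: room; rewrite c0].
  have [x [_ _ _ _ dx]] := common_nonneighbor a a degD em.
  have [z [zx _ nxz _ dz]] := common_nonneighbor x x degD em.
  apply: (step x z k.-1 zx nxz (lt2 x dx) (lt2 z dz)); try by case: (k) k2 => [|[]].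
  rewrite odd_vertices_add // 1?eq_sym // (cards0_eq T0E).
  rewrite (_ : [set w | _] = [set x; z]) ?cards2 1?eq_sym ?zx //.
  by apply/setP=> w; rewrite !inE.
move=> Tpos; have /card_gt0P[x xT] := Tpos.
have : 0 < #|odd_vertices H :\ x|.
  by move: evT Tpos; rewrite (cardsD1 x) xT; case: #|_|.
case/card_gt0P=> y; rewrite in_setD1 => /andP[yx yT].
have [z [zx zy nxz nyz dz]] := common_nonneighbor x y degD em.
have cT : #|odd_vertices H| = #|odd_vertices H :\ x :\ y|.+2.
  by rewrite (cardsD1 x) xT (cardsD1 y (_ :\ _)) in_setD1 yx yT.
have xz : x != z by rewrite eq_sym.
(* The first case burns one edge, moving oddness from [x] to [z]; the second removes [x] and [y]
   through the path [x], [z], [y]. *)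
case: (boolP ((2 < k) && (#|odd_vertices H| == 2))) => [/andP[k2 /eqP T2]|two].
  have TE : odd_vertices H = [set x; y].
    apply/esym/eqP; rewrite eqEcard T2 cards2 eq_sym yx andbT.
    by apply/subsetP=> w; rewrite !inE => /orP[] /eqP-> //; move: xT yT; rewrite !inE.
  apply: (step x z k.-1 zx nxz (oddlt x xT) (lt2 z dz)); try by case: (k) k2 => [|[]].
  rewrite odd_vertices_add // TE (_ : [set w | _] = [set z; y]) ?cards2 ?zy //.
  apply/setP=> w; rewrite !inE; case: (eqVneq w x) => [->|_] /=.
    by rewrite (negPf xz) eq_sym (negPf yx).
  case: (eqVneq w z) => [->|_] /=; last by case: eqP.
  by rewrite (negPf zy).
set H1 := add_edge H x z.
have n1 : ~~ adj H1 z y.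
  rewrite /= /adj_add adj_sym (negPf nyz) /= (negPf xz) /=.
  by rewrite (negPf zx) eq_sym (negPf yx) andbF.
have TE : odd_vertices (add_edge H1 z y) = odd_vertices H :\ x :\ y.
  rewrite odd_vertices_add // odd_vertices_add //; apply/setP=> w; rewrite !in_setD1.
  rewrite inE inE; case: (eqVneq w x) => [->|_] /=; last first.
  - case: (eqVneq w z) => [->|_] /=; first by rewrite zy; case: (_ \in _).
    by case: (eqVneq w y) => [->|_]; rewrite ?yT //= !addbF.
  by rewrite (negPf xz) eq_sym (negPf yx) /= xT.
rewrite cT !negbK in two Tk evT; clear step T0 em.
case: k => [|[|k]] // in IHk mE Tk two *.
case: (IHk k _ (add_edge H1 z y)); rewrite ?TE //.
- move=> v; rewrite degree_add // degree_add //.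
  case: (eqVneq v x) => [->|_] /=.
    by rewrite (negPf xz) eq_sym (negPf yx) addn0 addn1 oddlt.
  case: (eqVneq v z) => [->|_] /=; first by rewrite -addnA.
  by rewrite addn0; case: (eqVneq v y) => [->|_]; rewrite ?addn0 // addn1 oddlt.
- by rewrite card_edges_add // card_edges_add // mE !addnS.
(* If no odd vertex is left there were exactly two, so [two] bounds the old budget by 2 and the path
   has spent it. *)
- by move=> c0; left; move: two; rewrite c0 andbT -leqNgt; case: (k).
move=> H' [sub eH' TH']; exists H'; split=> // a b Hab.
exact/sub/sub_add_edge/sub_add_edge.
Qed.
End Extension.

(** * Numerical choice of the degree cap *)

Lemma degree_bound_room (q n m : nat) (D := ((q.-1 * n) %/ (4 * q)).+1.*2) :
    1 < q -> 1024 * q ^ 2 < n -> m ^ 2 <= n ^ 3 ->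
  D.+1.*2 * D.-1 + m.*2 < n * D.-1.
Proof.
move=> q1 nq mn.
have e0 := divn_eq (q.-1 * n) (4 * q).
have e1 : (q.-1 * n) %% (4 * q) < 4 * q by rewrite ltn_mod; lia.
move: e0 e1; rewrite /D; set t := _ %/ _; set r := _ %% _ => e0 r1.
have qn2 : 2 * n <= q * n by rewrite leq_mul2r q1 orbT.
have {}e0 : q * n = t * (4 * q) + r + n.
  by rewrite -e0 -{1}[q]prednK ?mulSn ?(ltnW q1) // addnC.
have n12 : 12 * q <= n.
  by apply: leq_trans (ltnW nq); rewrite leq_mul // leq_pmulr // ltnW.
(* Since $D$ is about $(q-1)n/(2q)$, the difference $n - 2(D+1)$ is about $n/q$; half of that
   absorbs the rounding because $n \geq 12q$. *)
have A : n <= 2 * q * (n - t.+1.*2.+1.*2) by rewrite mulnBr; lia.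
have B : n <= 8 * t.+1.*2.-1.
  suff : q * n < q * (8 * t.+1) by rewrite ltn_pmul2l ?(ltnW q1) //; lia.
  by lia.
(* Otherwise [A] and [B] give $n^2 \leq 32qm$; squaring and using $m^2 \leq n^3$ yields $n \leq
   1024q^2$, a contradiction. *)
rewrite -ltn_subRL -mulnBl ltnNge; apply/negP => le2m.
have H : n * n <= 32 * q * m.
  apply: leq_trans (leq_mul A B) _; rewrite mulnACA.
  by apply: leq_trans (leq_mul (leqnn _) le2m) _; lia.
suff : n ^ 4 <= 1024 * q ^ 2 * n ^ 3.
  have n3 : 0 < n ^ 3 by rewrite expn_gt0 (leq_ltn_trans _ nq).
  by rewrite expnS leq_pmul2r // leqNgt nq.
apply: (@leq_trans (1024 * q ^ 2 * m ^ 2)); last by rewrite leq_mul2l mn orbT.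
have -> : n ^ 4 = (n * n) ^ 2 by rewrite expnMn -expnD.
have -> : 1024 * q ^ 2 * m ^ 2 = (32 * q * m) ^ 2 by rewrite !expnMn.
by rewrite leq_sqr.
Qed.

(** * From real constants to the combinatorial bounds *)

Import Order.TTheory GRing.Theory Num.Theory.
Local Open Scope ring_scope.

Theorem theorem1 (R : realType) (alpha beta : R)
    (alpha_gt0 : 0 < alpha) (alpha_lt1 : alpha < 1)
    (beta_gt0 : 0 < beta) (beta_lt1 : beta < 1)
    (hab : beta + 40 * alpha ^+ 2 < 1 / 2) :
  exists N : nat, (1 <= N)%N /\
    forall n : nat, (N <= n)%N ->
    forall m : nat, (2 * n <= m)%N -> m%:R <= alpha * n%:R `^ (3 / 2) ->
    forall G : sgraph 'I_n, connected_graph G ->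
      (max_degree G)%:R <= beta * n%:R ->
      (#|edges G| <= m - n)%N ->
      eulerian_extendable m G.
Proof.
have gap : 0 < 1 - 2 * beta by nra.
(* An integer form of the gap below one half: $\beta \leq 1/2 - 1/(2q)$, which holds once $q \geq
   1/(1-2\beta)$. *)
have [q q1 betaq] : exists2 q : nat, (1 < q)%N & 2 * q%:R * beta <= q.-1%:R.
  have : (1 - 2 * beta)^-1 < (Num.bound (1 - 2 * beta)^-1)%:R.
    by apply: archi_boundP; rewrite invr_ge0 ltW.
  move: (Num.bound _) => B; rewrite -[_^-1]mul1r ltr_pdivrMr // => gB.
  by exists B.+2 => //=; rewrite -!natr1; nra.
exists (1025 * q ^ 2)%N; split=> [|n nN m mn malpha G conG degG bm].
  by rewrite muln_gt0 expn_gt0 (ltnW q1).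
have nq : (1024 * q ^ 2 < n)%N.
  by apply: leq_trans nN; rewrite ltn_pmul2r // expn_gt0 (ltnW q1).
have m2n3 : (m ^ 2 <= n ^ 3)%N.
  have mle : m%:R <= n%:R `^ (3 / 2) :> R.
    by apply: le_trans malpha _; rewrite ler_piMl ?powR_ge0 ?ltW.
  rewrite -(ler_nat R) !natrX -[n%:R ^+ 3]powR_mulrn ?ler0n //.
  rewrite (_ : 3%:R = 3 / 2 * 2%:R :> R); last by field.
  by rewrite powRrM powR_mulrn ?powR_ge0 // lerXn2r ?nnegrE ?powR_ge0 ?ler0n.
have n2 : (2 < n)%N.
  apply: leq_ltn_trans nq; apply: leq_trans (leq_pmulr 1024 _) => //.
  by rewrite expn_gt0 (ltnW q1).
pose D := ((q.-1 * n) %/ (4 * q)).+1.*2.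
have room : (D.+1.*2 * D.-1 + m.*2 < #|'I_n| * D.-1)%N.
  by rewrite card_ord degree_bound_room.
clear nN nq m2n3.
(* The maximum degree is at most $(q-1)n/(2q)$, and $D$ is twice the integer just above half of
   this. *)
have degD v : (degree G v <= D)%N.
  apply: leq_trans (leq_bigmax v) _; rewrite -/(max_degree G).
  have : (2 * q * max_degree G <= q.-1 * n)%N.
    rewrite -(ler_nat R) !natrM; apply: (@le_trans _ _ (2 * q%:R * (beta * n%:R))).
      by rewrite ler_wpM2l // mulr_ge0 ?ler0n.
    by rewrite mulrA ler_wpM2r ?ler0n.
  have q0 : (0 < q)%N by apply: ltnW.
  have q4 : (0 < 4 * q)%N by rewrite muln_gt0.
  have /[swap] /leq_ltn_trans /[apply] := ltn_ceil (q.-1 * n) q4.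
  have -> : (((q.-1 * n) %/ (4 * q)).+1 * (4 * q) = 2 * q * D)%N.
    by rewrite /D -muln2; move: (_ %/ _)%N => t; clear; lia.
  by rewrite ltn_pmul2l ?muln_gt0 // => /ltnW.
(* This budget covers all odd vertices and, as [2 < n], exceeds 2. *)
have nk : (n <= m - #|edges G|)%N.
  by move: bm mn; move: #|edges G| => b; clear; lia.
have [] := @even_completion _ D m _ _ (m - #|edges G|)%N G degD.
- by rewrite odd_double.
- exact: room.
- by rewrite subnKC // (leq_trans bm) // leq_subr.
- by apply: leq_trans (max_card _) _; rewrite card_ord.
- exact: even_odd_vertices.
- by right; apply: leq_trans nk.
move=> H [sub eH TH]; exists H; split=> //; split=> //.
apply: euler_circuit => [x y|v|].
- by apply: connect_sub (conG x y) => a b /sub /connect1.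
- by move/setP/(_ v): TH; rewrite !inE => ->.
by rewrite -card_gt0 eH (leq_trans _ mn) // muln_gt0 (ltnW (ltnW n2)).
Qed.
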